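(* Consider buyers sharing a router link of capacity $c>0$. If buyer $i$'s demand model is natural and routing is done using Strict Priority Queueing (SPQ), then, fixing the bids of the other buyers and the realized demand, buyer $i$'s allocation up to and including any epoch $t$ under the greedy policy is ex post monotone in her bid value $b_i$.
   Context: Time is divided into discrete epochs. Traffic is modeled as a flow; the router's link has fixed capacity $c>0$ per epoch. Each buyer $i$ submits one bid $b_i\ge 0$ before sending data. Demand: $x_{i,t}$ is the cumulative traffic (bytes) of buyer $i$ up to and including epoch $t$; this is her allocation up to and including epoch $t$. The random variable $D_i(t,x)$ is the demand of buyer $i$ in epoch $t$ (the maximum amount she wants to consume in that epoch) when her cumulative traffic so far is $x=x_{i,t-1}$; $d_i(t,x)$ denotes a realization, which can be thought of as realized for all $(t,x)$ when the buyer arrives. The demand model $D_i$ is natural if all realizations satisfy $x+\min(c',d_i(t,x))\ge x'+\min(c',d_i(t,x'))$ for all $t$, all $x\ge x'$ and all $c'\ge 0$. SPQ: in each epoch, capacity is allocated first to the buyer with the highest bid, up to $c$ or her demand, then to the buyer with the second highest bid, and so forth as long as capacity is available; ties are broken at random. $c_{i,t}$ denotes the network capacity available to buyer $i$ in epoch $t$. Greedy policy: given realized capacity $c_{i,t}$ and realized demand $d_{i,t}=d_i(t,x_{i,t-1})$ in epoch $t$, the buyer sends $\min(c_{i,t},d_{i,t})$ to the router in epoch $t$. Ex post monotone in $b_i$: whatever the bids of the others and whatever the realized demand, if $b_i''>b_i'$ then buyer $i$'s allocation under bid $b_i''$ is at least her allocation under bid $b_i'$. *)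

(* Defs.v *)
From HB Require Import structures.
From mathcomp Require Import all_boot all_order all_algebra all_fingroup.
From mathcomp Require Import all_classical all_reals all_analysis.

Set Implicit Arguments.
Unset Strict Implicit.
Unset Printing Implicit Defensive.

Import Order.TTheory GRing.Theory Num.Theory.

Local Open Scope ring_scope.

(* [D s x] is the random demand in epoch [s] of a buyer whose cumulative traffic
   up to epoch [s - 1] is [x].  Epochs are numbered from 1 and traffic is never
   negative, so only the values with [0 < s] and [0 <= x] are meaningful; the
   predicates below are restricted to them.  An outcome [w] fixes the realized
   demand [fun s x => D s x w] for all [(s, x)] at once. *)
Definition demand_model (d : measure_display) (Omega : measurableType d)
    (R : realType) (P : probability Omega R) : Type :=
  nat -> R -> {RV P >-> R}.

Definition nonneg_demand (d : measure_display) (Omega : measurableType d)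
    (R : realType) (P : probability Omega R) (D : demand_model P) : Prop :=
  forall (w : Omega) (s : nat) (x : R), (0 < s)%N -> 0 <= x -> 0 <= D s x w.

Definition natural_demand (d : measure_display) (Omega : measurableType d)
    (R : realType) (P : probability Omega R) (D : demand_model P) : Prop :=
  forall (w : Omega) (s : nat) (x x' c' : R),
    (0 < s)%N -> 0 <= x' -> x' <= x -> 0 <= c' ->
    x' + Num.min c' (D s x' w) <= x + Num.min c' (D s x w).

(* The buyers by decreasing bid.  [tie] is the outcome of the random
   tie-breaking: among equal bids, the smaller rank [tie j] goes first.  Bids
   are submitted once, so the ranks are drawn once, before the first epoch, and
   independently of the bids. *)
Definition priority_order (R : realType) (n : nat) (b : 'I_n -> R)
    (tie : {perm 'I_n}) : seq 'I_n :=
  sort (fun j k => (b k < b j) || (b j == b k) && (tie j <= tie k)%N)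
       (enum 'I_n).

(* The capacity left for buyer [i] within one epoch, when the buyers in [q] are
   served in that order out of a capacity [cap] and buyer [j] demands [dem j].
   The value for [i \notin q] is irrelevant: [priority_order] lists everyone. *)
Fixpoint available_capacity (R : realType) (n : nat) (q : seq 'I_n) (cap : R)
    (dem : 'I_n -> R) (i : 'I_n) : R :=
  match q with
  | [::] => 0
  | j :: q' =>
      if j == i then cap
      else available_capacity q' (cap - Num.min cap (dem j)) dem i
  end.

(* [traffic c b tie dem t i] is the traffic x_{i,t} of buyer [i] up to and
   including epoch [t], for the realized demands [dem], under SPQ and the greedy
   policy. *)
Fixpoint traffic (R : realType) (n : nat) (c : R) (b : 'I_n -> R)
    (tie : {perm 'I_n}) (dem : 'I_n -> nat -> R -> R) (t : nat) : 'I_n -> R :=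
  match t with
  | 0%N => fun=> 0
  | s.+1 =>
      let x := traffic c b tie dem s in
      let dem_t j := dem j s.+1 (x j) in
      fun i =>
        let c_it := available_capacity (priority_order b tie) c dem_t i in
        x i + Num.min c_it (dem_t i)
  end.

(* [X b tie w] is the allocation of buyer [i] for the bids [b], the tie-breaking
   ranks [tie] and the outcome [w] of the demands.  The value [b i] is
   overwritten, so [b] only stands for the bids of the other buyers. *)
Definition ex_post_monotone (Omega : Type) (R : realType) (n : nat) (i : 'I_n)
    (X : ('I_n -> R) -> {perm 'I_n} -> Omega -> R) : Prop :=
  forall (b : 'I_n -> R) (tie : {perm 'I_n}) (w : Omega) (bi' bi'' : R),
    (forall j, j != i -> 0 <= b j) -> 0 <= bi' -> bi' < bi'' ->
    X [eta b with i |-> bi'] tie w <= X [eta b with i |-> bi''] tie w.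

(* Main.v *)
Require Import Defs.
From HB Require Import structures.
From mathcomp Require Import all_boot all_order all_algebra all_fingroup.
From mathcomp Require Import all_classical all_reals all_analysis.

Set Implicit Arguments.
Unset Strict Implicit.
Unset Printing Implicit Defensive.

Import Order.TTheory GRing.Theory Num.Theory.

Local Open Scope ring_scope.

(** Let buyer [i] raise her bid. The buyers with priority over her form a prefix
    [p'] of the service order before the raise, and a shorter prefix [p''] of
    [p'] after it. The allocations of the buyers in [p''] depend on nobody
    outside [p''], so they are the same in both scenarios; hence in every epoch
    [i] sees at least as much capacity after the raise. By induction on the
    epochs her cumulative traffic is larger: naturality compares the two
    cumulative traffics at the old capacity, and the extra capacity only helps. *)

(** The comparison that [priority_order] sorts by, named so that the general facts on sorted lists
    can be applied to it. *)
Definition served_before (R : realType) (n : nat) (b : 'I_n -> R)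
    (tie : {perm 'I_n}) : rel 'I_n :=
  fun j k => (b k < b j) || (b j == b k) && (tie j <= tie k)%N.

Section ServedBefore.
Variables (R : realType) (n : nat) (b : 'I_n -> R) (tie : {perm 'I_n}).

Lemma served_before_total : total (served_before b tie).
Proof.
move=> j k; rewrite /served_before.
by case: ltgtP => //= _; apply: leq_total.
Qed.

Lemma served_before_trans : transitive (served_before b tie).
Proof.
move=> k j l; rewrite /served_before.
move=> /orP[lt_kj|/andP[/eqP-> le_jk]] /orP[lt_lk|/andP[/eqP eq_kl le_kl]].
- by rewrite (lt_trans lt_lk).
- by rewrite -eq_kl lt_kj.
- by rewrite lt_lk.
- by rewrite eq_kl eqxx (leq_trans le_jk) ?orbT.
Qed.

Lemma served_before_anti : antisymmetric (served_before b tie).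
Proof.
move=> j k; rewrite /served_before.
case: ltgtP => //= _ le_tie.
by apply: (@perm_inj _ tie); apply/val_inj/anti_leq.
Qed.

Lemma priority_order_sorted :
  sorted (served_before b tie) (priority_order b tie).
Proof. exact: sort_sorted served_before_total _. Qed.

Lemma mem_priority_order j : j \in priority_order b tie.
Proof. by rewrite mem_sort mem_enum. Qed.

Lemma priority_order_uniq : uniq (priority_order b tie).
Proof. by rewrite sort_uniq enum_uniq. Qed.

Lemma priority_order_split i : exists p r,
  [/\ priority_order b tie = p ++ i :: r, i \notin p, i \notin r,
      {in p, forall j, served_before b tie j i} &
      {in r, forall j, served_before b tie i j}].
Proof.
have := priority_order_uniq; have := priority_order_sorted.
case/splitPr: (mem_priority_order i) => p r.
rewrite (sorted_pairwise served_before_trans) pairwise_cat /=.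
move=> /and3P[/allrelP p_before _ /andP[/allP i_before _]].
rewrite cat_uniq /= negb_or.
move=> /and3P[_ /andP[ip _] /andP[ir _]].
exists p, r; split => // j jp.
by apply: p_before => //; rewrite mem_head.
Qed.

End ServedBefore.

(** The two comparisons agree away from [i], so both lists are sorted for [served_before b' tie].
    They are permutations of each other, and a sorted list is unique for an antisymmetric order. *)
Lemma priority_order_others (R : realType) (n : nat) (b b' : 'I_n -> R)
    (tie : {perm 'I_n}) (i : 'I_n) :
  (forall j, j != i -> b j = b' j) ->
  [seq j <- priority_order b tie | j != i] =
  [seq j <- priority_order b' tie | j != i].
Proof.
move=> eq_b.
apply: (sorted_eq (@served_before_trans _ _ b' tie)
                  (@served_before_anti _ _ b' tie)).
- rewrite -(@eq_in_sorted _ (fun j => j != i) (served_before b tie)).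
  + apply: sorted_filter; first exact: served_before_trans.
    exact: priority_order_sorted.
  + by move=> j k ji ki; rewrite /served_before !eq_b.
  + exact: filter_all.
- apply: sorted_filter; first exact: served_before_trans.
  exact: priority_order_sorted.
- apply: perm_filter; rewrite /priority_order perm_sort perm_sym perm_sort.
  exact: perm_refl.
Qed.

(** Without [i] the two orders coincide, so the parts [p'] and [p''] ahead of [i] are prefixes of
    one list. It remains to exclude that [p''] is the longer one. *)
Lemma priority_order_raise (R : realType) (n : nat) (b' b'' : 'I_n -> R)
    (tie : {perm 'I_n}) (i : 'I_n) :
  (forall j, j != i -> b' j = b'' j) -> b' i < b'' i ->
  exists p m r r',
    [/\ priority_order b' tie = (p ++ m) ++ i :: r,
        priority_order b'' tie = p ++ i :: r' & i \notin p ++ m].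
Proof.
move=> eq_b lt_bi; have := priority_order_others tie eq_b.
have [p' [r' [-> ip' ir' _ r'_after]]] := priority_order_split b' tie i.
have [p'' [r'' [-> ip'' ir'' p''_before _]]] := priority_order_split b'' tie i.
have filter_id (s : seq 'I_n) : i \notin s -> [seq j <- s | j != i] = s.
  move=> i_s; apply/all_filterP/allP => j js.
  by apply: contraNneq i_s => <-.
rewrite !filter_cat /= eqxx !filter_id // => eq_others.
have [le_size|lt_size] := leqP (size p'') (size p').
  have p'E : p' = p'' ++ drop (size p'') p'.
    rewrite -[LHS](cat_take_drop (size p'')); congr (_ ++ _).
    have := congr1 (take (size p'')) eq_others.
    (* [take_cat] tests a strict inequality, so equal sizes form a separate case. *)
    by rewrite take_cat take_size_cat // ltn_neqAle le_size andbT;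
       case: eqP => //= ->; rewrite subnn take0 cats0 take_size.
  by exists p'', (drop (size p'') p'), r', r''; rewrite -p'E.
(* The entry of [p''] just past [p'] is the head of [r']: a buyer behind [i] before the raise and
   ahead of her after it. *)
have nth_p'' : nth i p'' (size p') \in p'' by rewrite mem_nth.
have nth_r' : nth i p'' (size p') \in r'.
  have /(congr1 (fun s => nth i s (size p'))) := eq_others.
  rewrite !nth_cat ltnn subnn lt_size => <-.
  (* If [r'] were empty, [p'] would be at least as long as [p'']. *)
  rewrite mem_nth //; move/(congr1 size): eq_others; rewrite !size_cat.
  case: (size r') => // /eqP; rewrite addn0 => /eqP size_p'.
  by move: lt_size; rewrite size_p' ltnNge leq_addr.
have := p''_before _ nth_p''; have := r'_after _ nth_r'.
have ji : nth i p'' (size p') != i by apply: contraNneq ip'' => <-.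
rewrite /served_before eq_b // => before' before''.
(* Whatever the tie ranks, this buyer's bid is at most the old bid of [i] and at least the new
   one. *)
have le' : b'' (nth i p'' (size p')) <= b' i.
  by case/orP: before' => [/ltW|/andP[/eqP->]].
have le'' : b'' i <= b'' (nth i p'' (size p')).
  by case/orP: before'' => [/ltW|/andP[/eqP->]].
by move: lt_bi; rewrite ltNge (le_trans le'' le').
Qed.

Section AvailableCapacity.
Variables (R : realType) (n : nat).
Implicit Types (p q r : seq 'I_n) (cap : R) (dem : 'I_n -> R).

Lemma available_capacity_prefix p r r' cap dem dem' j :
    {in p, dem =1 dem'} -> j \in p ->
  available_capacity (p ++ r) cap dem j =
  available_capacity (p ++ r') cap dem' j.
Proof.
elim: p cap => //= k p IHp cap eq_dem; rewrite inE eq_sym.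
case: eqP => //= _ jp; rewrite eq_dem ?mem_head //.
by apply: IHp => // l lp; apply: eq_dem; rewrite inE lp orbT.
Qed.

(** As a fold, the capacity left for [i] can be split along [p ++ m] by [foldl_cat]. *)
Lemma available_capacity_at p r cap dem i : i \notin p ->
  available_capacity (p ++ i :: r) cap dem i =
  foldl (fun a j => a - Num.min a (dem j)) cap p.
Proof.
elim: p cap => [|k p IHp] cap /=; first by rewrite eqxx.
by rewrite inE negb_or eq_sym => /andP[/negPf-> /IHp->].
Qed.

Lemma available_capacity_ge0 q cap dem i :
  0 <= cap -> 0 <= available_capacity q cap dem i.
Proof.
elim: q cap => //= k q IHq cap cap_ge0; case: eqP => // _.
by apply: IHq; rewrite subr_ge0 ge_min lexx.
Qed.

Lemma remaining_capacity_le p cap dem : 0 <= cap -> (forall j, 0 <= dem j) ->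
  foldl (fun a j => a - Num.min a (dem j)) cap p <= cap.
Proof.
move=> + dem_ge0; elim: p cap => //= k p IHp cap cap_ge0.
apply: le_trans (IHp _ _) _; first by rewrite subr_ge0 ge_min lexx.
by rewrite gerBl le_min cap_ge0 dem_ge0.
Qed.

Lemma remaining_capacity_ge0 p cap dem : 0 <= cap ->
  0 <= foldl (fun a j => a - Num.min a (dem j)) cap p.
Proof.
elim: p cap => //= k p IHp cap cap_ge0.
by apply: IHp; rewrite subr_ge0 ge_min lexx.
Qed.

Lemma eq_remaining_capacity p cap dem dem' : {in p, dem =1 dem'} ->
  foldl (fun a j => a - Num.min a (dem j)) cap p =
  foldl (fun a j => a - Num.min a (dem' j)) cap p.
Proof.
elim: p cap => //= k p IHp cap eq_dem.
rewrite eq_dem ?mem_head //; apply: IHp => l lp.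
by apply: eq_dem; rewrite inE lp orbT.
Qed.

End AvailableCapacity.

Section Traffic.
Variables (R : realType) (n : nat) (c : R) (dem : 'I_n -> nat -> R -> R).
Hypothesis c_ge0 : 0 <= c.
Hypothesis dem_ge0 : forall j s x, (0 < s)%N -> 0 <= x -> 0 <= dem j s x.
Variable tie : {perm 'I_n}.

Lemma traffic_ge0 b t j : 0 <= traffic c b tie dem t j.
Proof.
elim: t j => //= t IHt j.
by rewrite addr_ge0 // le_min available_capacity_ge0 // dem_ge0.
Qed.

(** Equal past traffic on [p] gives equal demands there, hence equal capacities in the next
    epoch. *)
Lemma traffic_prefix b b' p r r' t :
    priority_order b tie = p ++ r -> priority_order b' tie = p ++ r' ->
  {in p, traffic c b tie dem t =1 traffic c b' tie dem t}.
Proof.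
move=> bE b'E; elim: t => //= t IHt j jp.
rewrite bE b'E IHt //; congr (_ + Num.min _ _).
by apply: available_capacity_prefix => // k kp; rewrite IHt.
Qed.

Lemma traffic_raise b' b'' i t :
    (forall s x x' c', (0 < s)%N -> 0 <= x' -> x' <= x -> 0 <= c' ->
      x' + Num.min c' (dem i s x') <= x + Num.min c' (dem i s x)) ->
    (forall j, j != i -> b' j = b'' j) -> b' i < b'' i ->
  traffic c b' tie dem t i <= traffic c b'' tie dem t i.
Proof.
move=> natural eq_b lt_bi.
have [p [m [r [r' [b'E b''E i_pm]]]]] := priority_order_raise tie eq_b lt_bi.
have ip : i \notin p by move: i_pm; rewrite mem_cat negb_or => /andP[].
elim: t => //= t IHt; set x' := traffic c b' tie dem t in IHt *.
set x'' := traffic c b'' tie dem t in IHt *.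
set c' := available_capacity _ _ _ _; set c'' := available_capacity _ _ _ _.
have c'_ge0 : 0 <= c' by apply: available_capacity_ge0.
have le_c : c' <= c''.
  rewrite /c' /c'' b'E b''E !available_capacity_at // foldl_cat.
  (* Once the demands on [p] are identified, the two folds differ only by serving [m], which cannot
     increase what is left. *)
  rewrite (@eq_remaining_capacity _ _ p c _ (fun j => dem j t.+1 (x'' j))).
    apply: remaining_capacity_le; first exact: remaining_capacity_ge0.
    by move=> j; apply: dem_ge0 => //; apply: traffic_ge0.
  move=> j jp; congr (dem j t.+1 _); move: j jp.
  by apply: traffic_prefix b''E; rewrite b'E -catA.
(* The intermediate value is the new traffic [x''] extended by what [i] would send with the old
   capacity [c']. *)
apply: le_trans (natural _ _ _ _ _ _ IHt c'_ge0) _ => //.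
  exact: traffic_ge0.
by rewrite lerD2l le_min !ge_min le_c lexx orbT.
Qed.

End Traffic.

Theorem lemma4p2 (d : measure_display) (Omega : measurableType d)
    (R : realType) (P : probability Omega R)
    (n : nat) (c : R) (c_gt0 : 0 < c)
    (D : 'I_n -> demand_model P) (D_ge0 : forall j, nonneg_demand (D j))
    (i : 'I_n) (Di_natural : natural_demand (D i)) (t : nat) :
  ex_post_monotone i
    (fun b tie w => traffic c b tie (fun j s x => D j s x w) t i).
Proof.
move=> b tie w bi' bi'' _ _ lt_bi; apply: traffic_raise.
- exact: ltW.
- by move=> j s x; apply: D_ge0.
- by move=> s x x' c'; apply: Di_natural.
- by move=> j /negPf ji /=; rewrite ji.
- by rewrite /= eqxx.
Qed.
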